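(* A $d\times d$ correlation matrix $P$ is a Kendall rank correlation matrix if and only if $P$ can be represented as a convex combination of the extremal correlation matrices in dimension $d$, that is, $$P = \sum_{k=1}^{2^{d-1}} w_k P^{(k)}$$ for some $w_k\ge 0$ with $\sum_{k=1}^{2^{d-1}} w_k = 1$.
   Context: Let $d\ge 2$. A correlation matrix is a real symmetric positive semi-definite matrix with ones on the diagonal. For a random vector $\boldsymbol{X}=(X_1,\ldots,X_d)$ with continuous margins, the Kendall rank correlation matrix $P_\tau(\boldsymbol{X})$ is the $d\times d$ matrix with unit diagonal and $(i,j)$ entry ($i\neq j$) equal to Kendall's tau $\tau_{\{i,j\}} = 2\kappa_{\{i,j\}}-1$, where $\kappa_{\{i,j\}} = \mathbb{P}(\{X_i\le X_i^*, X_j\le X_j^*\}\cup\{X_i^*\le X_i, X_j^*\le X_j\})$ and $\boldsymbol{X}^*$ is an independent copy of $\boldsymbol{X}$. A matrix is called a Kendall rank correlation matrix if it equals $P_\tau(\boldsymbol{X})$ for some random vector $\boldsymbol{X}$ with continuous margins (equivalently, for some $\boldsymbol{X}$ distributed according to a $d$-dimensional copula). The extremal correlation matrices are $P^{(k)} = (2\boldsymbol{s}_k-\boldsymbol{1})(2\boldsymbol{s}_k-\boldsymbol{1})^\top$, $k\in\{1,\ldots,2^{d-1}\}$, where $\boldsymbol{s}_k\in\{0,1\}^d$ is the (column) vector of digits of $k-1$ written as a $d$-digit binary number and $\boldsymbol{1}$ is the vector of ones; these are exactly the correlation matrices with all entries in $\{-1,1\}$. *)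

(* Defs.v *)
From mathcomp Require Import all_boot all_order all_algebra.
From mathcomp Require Import all_classical all_reals all_analysis.

Set Implicit Arguments.
Unset Strict Implicit.
Unset Printing Implicit Defensive.

Import Order.TTheory GRing.Theory Num.Theory.
Import numFieldNormedType.Exports.

Local Open Scope classical_set_scope.
Local Open Scope ring_scope.

Definition correlation_mx (R : realType) (d : nat) (A : 'M[R]_d) : Prop :=
  [/\ A^T = A,
      forall x : 'cV[R]_d, 0 <= (x^T *m A *m x) 0 0
    & forall i, A i i = 1].

(* The column vector of the digits of n written as a d-digit binary number,
   most significant digit first. *)
Definition binary_digits (R : realType) (d n : nat) : 'cV[R]_d :=
  \col_(i < d) (odd (n %/ 2 ^ (d - i.+1)))%:R.

(* Indices are shifted by one with respect to the usual numbering
   P^(1), ..., P^(2^(d-1)): the matrix P^(k) is [extremal_mx R d k.-1], so the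
   extremal matrices are the [extremal_mx R d k] with k < 2 ^ d.-1. *)
Definition extremal_mx (R : realType) (d k : nat) : 'M[R]_d :=
  let v : 'cV[R]_d := 2 *: binary_digits R d k - const_mx 1 in v *m v^T.

Section Kendall.
Context (R : realType) (d : nat) (disp : measure_display)
  (T : measurableType disp) (Pr : probability T R).

(* [d.-tuple R] carries the product sigma-algebra, so this is the random vector
   (X_0, ..., X_(d-1)) as a measurable map. *)
Definition joint (X : 'I_d -> {RV Pr >-> R}) (w : T) : d.-tuple R :=
  [tuple X i w | i < d].

Definition same_law (X Y : 'I_d -> {RV Pr >-> R}) : Prop :=
  forall A : set (d.-tuple R), measurable A ->
    Pr (joint X @^-1` A) = Pr (joint Y @^-1` A).

Definition independent (X Y : 'I_d -> {RV Pr >-> R}) : Prop :=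
  forall A B : set (d.-tuple R), measurable A -> measurable B ->
    Pr (joint X @^-1` A `&` joint Y @^-1` B) =
    (Pr (joint X @^-1` A) * Pr (joint Y @^-1` B))%E.

Definition independent_copy (X Xs : 'I_d -> {RV Pr >-> R}) : Prop :=
  same_law X Xs /\ independent X Xs.

Definition continuous_margins (X : 'I_d -> {RV Pr >-> R}) : Prop :=
  forall i, continuous (cdf (X i)).

Definition kappa (X Xs : 'I_d -> {RV Pr >-> R}) (i j : 'I_d) : R :=
  fine (Pr ([set w | X i w <= Xs i w /\ X j w <= Xs j w] `|`
            [set w | Xs i w <= X i w /\ Xs j w <= X j w])).

Definition kendall_tau (X Xs : 'I_d -> {RV Pr >-> R}) (i j : 'I_d) : R :=
  2 * kappa X Xs i j - 1.

Definition kendall_mx (X Xs : 'I_d -> {RV Pr >-> R}) : 'M[R]_d :=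
  \matrix_(i, j) if i == j then 1 else kendall_tau X Xs i j.

End Kendall.

(* [kendall_mx X Xs] depends only on the law of X when Xs is an independent copy
   of X. Quantifying over the probability space as well ensures that it can be
   taken rich enough to carry such a copy. *)
Definition kendall_rank_correlation_mx (R : realType) (d : nat) (A : 'M[R]_d) :
    Prop :=
  exists (disp : measure_display) (T : measurableType disp)
         (Pr : probability T R) (X Xs : 'I_d -> {RV Pr >-> R}),
    [/\ continuous_margins X, independent_copy X Xs & A = kendall_mx X Xs].

(* Main.v *)
From HB Require Import structures.
Require Import Defs.
From mathcomp Require Import all_boot all_order all_algebra.
From mathcomp Require Import all_classical all_reals all_analysis.
From mathcomp Require Import measurable_realfun lra.

Set Implicit Arguments.
Unset Strict Implicit.
Unset Printing Implicit Defensive.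

Import Order.TTheory GRing.Theory Num.Theory.
Import numFieldNormedType.Exports.

Local Open Scope classical_set_scope.
Local Open Scope ring_scope.

(** Let Y be an independent copy of X, and write S_i = +1 if X_i < Y_i and
    S_i = -1 if X_i > Y_i. Continuity of the margins makes ties X_i = Y_i
    null events, so almost surely S is a vector of signs, and the
    concordance event of the pair (i, j) is {S_i = S_j} up to a null set:
    Kendall's tau is the expectation of S_i S_j. The matrix S S^T is
    unchanged when S is replaced by -S, hence is always an extremal matrix
    P^(k), and the Kendall matrix is E[S S^T] = sum_k w_k P^(k), where w_k
    is the probability that S is plus or minus the sign vector of P^(k).
    This is [kendall_mx_mixture]; the absence of ties
    ([independent_copy_no_ties]) holds because the joint law of (X_i, Y_i)
    is a product measure with atomless factors, which gives mass 0 to the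
    diagonal.

    Conversely, given weights w_k, take U uniform on [0, 1], cut [0, 1] into
    consecutive slices, and let X_i = U or X_i = -U according to the i-th
    digit of the index k of the slice that contains U. With an independent
    copy V, the larger of U and V decides all comparisons between X and Y at
    once: if U < V and V lies in slice k, then X_i < Y_i exactly when the
    i-th digit of k is 1; if V < U and U lies in slice k, exactly when it is
    0. So, almost surely, S is plus or minus the k-th sign vector whenever
    max(U, V) lies in slice k. Since max(U, V) <= b has probability b^2, placing the cuts at
    the square roots of the partial sums of the weights gives this event
    probability w_k ([kendall_mx_of_mixture]).

    Both directions compute the Kendall matrix with the same lemma,
    [kendall_mx_partition]: if disjoint events E_k of total probability 1
    are such that S is plus or minus the k-th sign vector on E_k, then the
    Kendall matrix is the mixture of the extremal matrices with weights
    P(E_k). *)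

(** * Continuous distribution functions and atoms *)

Section cdf_continuity.
Context (R : realType) (disp : measure_display) (T : measurableType disp)
  (Pr : probability T R) (X : {RV Pr >-> R}).

(** Monotonicity of the cdf reduces the left limit to the sequence a - 1/(n+1),
    along which it is continuity of the measure from below. *)
Lemma cvg_cdf_at_left a :
  cdf X r @[r --> a^'-] --> Pr (X @^-1` `]-oo, a[).
Proof.
have mX A : measurable A -> measurable (X @^-1` A).
  by move=> mA; exact: measurable_funPTI.
pose F n := X @^-1` `]-oo, a - n.+1%:R^-1].
have UF : \bigcup_n F n = X @^-1` `]-oo, a[.
  rewrite -preimage_bigcup; congr (X @^-1` _); apply/seteqP; split => x.
    by case=> n _; rewrite /= !in_itv/= => /le_lt_trans; apply; rewrite gtrBl.
  rewrite /= in_itv/= => xa.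
  have : 0 < a - x by rewrite subr_gt0.
  move=> /ltr_add_invr[n]; rewrite add0r => nax; exists n => //=.
  by rewrite in_itv/= lerBrDr addrC -lerBrDr ltW.
have Fcvg : Pr (F n) @[n --> \oo] --> Pr (X @^-1` `]-oo, a[).
  rewrite -UF; apply: nondecreasing_cvg_mu => [n||m n mn].
  - exact: mX.
  - by apply: bigcup_measurable => n _; exact: mX.
  - apply/subsetPset => w; rewrite /F/= !in_itv/= => /le_trans; apply.
    by rewrite lerD2l lerN2 lef_pV2 ?posrE// ler_nat.
have PE A : measurable A -> (fine (Pr A))%:E = Pr A.
  by move=> mA; rewrite fineK// fin_num_measure.
rewrite -PE; last exact: mX.
apply/fine_cvgP; split.
  by near=> r; rewrite fin_num_measure.
move: Fcvg; rewrite -PE; last exact: mX.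
move=> /fine_cvgP[_] /cvgrPdist_lt Fcvg.
apply/cvgrPdist_lt => e e0; have [N _ /(_ N (leqnn N))/= FN] := Fcvg _ e0.
near=> r.
have ra : r < a by near: r; exact: nbhs_left_lt.
have Nr : a - N.+1%:R^-1 <= r.
  by near: r; apply: nbhs_left_ge; rewrite gtrBl.
have le1 : fine (Pr (F N)) <= fine (cdf X r).
  apply: fine_le; [exact/fin_num_measure/mX|exact: fin_num_measure|].
  exact: cdf_nondecreasing.
have le2 : fine (cdf X r) <= fine (Pr (X @^-1` `]-oo, a[)).
  apply: fine_le; [exact: fin_num_measure|exact/fin_num_measure/mX|].
  apply: (@le_measure _ _ _ (distribution Pr X)); rewrite ?inE//.
  by move=> w; rewrite /= !in_itv/= => /le_lt_trans; apply.
apply: le_lt_trans FN; rewrite /= !ger0_norm ?subr_ge0 ?lerD2l ?lerN2//.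
exact: le_trans le2.
Unshelve. all: by end_near. Qed.

Lemma cdfE a :
  cdf X a = (Pr (X @^-1` `]-oo, a[) + Pr (X @^-1` [set a]))%E.
Proof.
rewrite -measureU.
- by rewrite /cdf /distribution /pushforward -preimage_setU setUitv1.
- exact: measurable_funPTI.
- exact: measurable_funPTI.
- by apply/seteqP; split => // w [] /[swap] /= ->; rewrite in_itv/= ltxx.
Qed.

(** The jump of the cdf at a is the mass of the atom a, and right continuity is
    automatic. *)
Lemma continuous_cdfP :
  continuous (cdf X) <-> forall a, Pr (X @^-1` [set a]) = 0%E.
Proof.
have fin A : measurable A -> Pr (X @^-1` A) \is a fin_num.
  by move=> mA; rewrite fin_num_measure//; exact: measurable_funPTI.
split=> [cX a|P0 a].
  have /left_right_continuousP[la _] := cX a.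
  have : cdf X a = Pr (X @^-1` `]-oo, a[).
    by apply: (cvg_unique _ la (cvg_cdf_at_left (a := a))).
  rewrite cdfE => /(congr1 fine)/eqP; rewrite fineD ?fin//.
  by rewrite addrC -subr_eq0 addrK fine_eq0 ?fin// => /eqP.
apply/left_right_continuousP; split; last exact: cdf_right_continuous.
by rewrite cdfE P0 adde0; exact: cvg_cdf_at_left.
Qed.

End cdf_continuity.

(** * Ties between independent copies *)

Lemma measurable_diag (R : realType) : measurable [set z : R * R | z.1 = z.2].
Proof.
rewrite (_ : mkset _ = setT `&` (fun z : R * R => z.1 == z.2) @^-1` [set true]).
  exact: (measurable_fun_eqr measurable_fst measurable_snd).
by rewrite setTI; apply/seteqP; split => z /= /eqP.
Qed.

(** The sections of the diagonal are single points. *)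
Lemma product_measure_diag (R : realType) (mu nu : probability R R) :
  (forall a, nu [set a] = 0%E) -> (mu \x nu)%E [set z | z.1 = z.2] = 0%E.
Proof.
move=> nu0; rewrite /product_measure1; apply: integral0_eq => x _ /=.
rewrite (_ : xsection _ x = [set x])//.
by apply/seteqP; split => y; rewrite /xsection/= inE/=.
Qed.

Section ties.
Context (R : realType) (d : nat) (disp : measure_display)
  (T : measurableType disp) (Pr : probability T R).

Lemma measurable_cylinder (i : 'I_d) (A : set R) :
  measurable A -> measurable [set t : d.-tuple R | A (tnth t i)].
Proof.
by move=> mA; rewrite -[X in measurable X]setTI; exact: measurable_tnth.
Qed.

Lemma joint_cylinder (Y : 'I_d -> {RV Pr >-> R}) i (A : set R) :
  joint Y @^-1` [set t | A (tnth t i)] = Y i @^-1` A.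
Proof. by apply/seteqP; split => w; rewrite /= tnth_mktuple. Qed.

Variables X Xs : 'I_d -> {RV Pr >-> R}.

(** The law of (X i, Xs i) agrees with the product of the two margins on
    rectangles, hence everywhere, in particular on the diagonal. *)
Lemma independent_copy_no_ties : continuous_margins X ->
  independent_copy X Xs -> forall i, Pr [set w | X i w = Xs i w] = 0%E.
Proof.
move=> cX [law indep] i.
have mZ : measurable_fun setT (fun w => (X i w, Xs i w)).
  by apply: measurable_fun_pair; exact: measurable_funPT.
pose Z : {mfun T >-> (R * R)%type} :=
  HB.pack (fun w => (X i w, Xs i w)) (isMeasurableFun.Build _ _ _ _ _ mZ).
transitivity (distribution Pr Z [set z | z.1 = z.2]); first by [].
rewrite -(@product_measure_unique _ _ _ _ _
  (distribution Pr (X i)) (distribution Pr (Xs i))).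
- apply: product_measure_diag => a.
  have := law _ (measurable_cylinder i (measurable_set1 a)).
  rewrite !joint_cylinder => lawE; apply: (etrans (esym lawE)).
  by have /continuous_cdfP := cX i; exact.
- move=> A B mA mB.
  have := indep _ _ (measurable_cylinder i mA) (measurable_cylinder i mB).
  by rewrite !joint_cylinder.
- exact: measurable_diag.
Qed.

End ties.

(** * Extremal matrices and sign patterns *)

(** The entry i of the column [binary_digits R d k], as a boolean. *)
Definition digit (d k : nat) (i : 'I_d) : bool := odd (k %/ 2 ^ (d - i.+1)).

Lemma extremal_mxE (R : realType) d k (i j : 'I_d) :
  extremal_mx R d k i j = if digit k i == digit k j then 1 else -1.
Proof.
rewrite !mxE big_ord1 !mxE -/(digit k i) -/(digit k j).
by case: (digit k i); case: (digit k j) => /=; lra.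
Qed.

Lemma eq_sumr_if (R : realType) (n : nat) (P : pred 'I_n) (p : 'I_n -> R) :
  \sum_k p k = 1 ->
  \sum_k p k * (if P k then 1 else -1) = 2 * (\sum_(k | P k) p k) - 1.
Proof.
move=> p1; rewrite [LHS](bigID P)/= -[X in _ = _ - X]p1.
rewrite [X in _ = _ - X](bigID P)/=.
rewrite (eq_bigr p); last by move=> k ->; rewrite mulr1.
rewrite [X in _ + X](eq_bigr (fun k => - p k)); last first.
  by move=> k /negbTE->; rewrite mulrN1.
by rewrite sumrN; lra.
Qed.

Section partition.
Context (R : realType) (d : nat) (disp : measure_display)
  (T : measurableType disp) (Pr : probability T R).

Lemma measurable_RV_lt (X Y : {RV Pr >-> R}) : measurable [set w | X w < Y w].
Proof.
rewrite -[X in measurable X]setTI.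
have := measurable_fun_ltr (measurable_funPT X) (measurable_funPT Y).
by move=> /(_ measurableT [set true]); apply.
Qed.

Lemma measurable_RV_le (X Y : {RV Pr >-> R}) : measurable [set w | X w <= Y w].
Proof.
rewrite -[X in measurable X]setTI.
have := measurable_fun_ler (measurable_funPT X) (measurable_funPT Y).
by move=> /(_ measurableT [set true]); apply.
Qed.

Variables X Xs : 'I_d -> {RV Pr >-> R}.

(** On E_k the pair (i, j) is concordant exactly when the digits i and j of k
    agree; the boolean b is the global sign that the extremal matrix does not
    see. So each entry of the Kendall matrix is a signed sum of the P(E_k). *)
Lemma kendall_mx_partition n (E : 'I_n -> set T) (p : 'I_n -> R) :
  (forall k, measurable (E k)) -> trivIset setT E ->
  (forall k, Pr (E k) = (p k)%:E) -> \sum_k p k = 1 ->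
  (forall k w, E k w -> exists b, forall i,
    X i w <> Xs i w /\ (X i w < Xs i w) = digit k i (+) b) ->
  kendall_mx X Xs = \sum_k p k *: extremal_mx R d k.
Proof.
move=> mE tE pE p1 signE; apply/matrixP => i j.
rewrite summxE.
under eq_bigr do rewrite mxE extremal_mxE.
rewrite eq_sumr_if// mxE; case: eqP => [->|_].
  by rewrite (eq_bigl predT) ?p1; [lra|move=> k; rewrite eqxx].
congr (2 * _ - 1); rewrite /kappa; set C := (X in Pr X).
have mC : measurable C.
  by apply: measurableU; apply: measurableI; exact: measurable_RV_le.
pose F (P : {pred 'I_n}) := \bigcup_(k in [set` P]) E k.
have mF P : measurable (F P).
  by rewrite /F bigcup_pred; exact: bigsetU_measurable.
have PF P : Pr (F P) = (\sum_(k in P) p k)%:E.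
  rewrite /F bigcup_pred measure_bigsetU_ord//.
  by rewrite (eq_bigr (fun k => (p k)%:E)) ?sumEFin// => k _; exact: pE.
pose Q : {pred 'I_n} := [pred k : 'I_n | digit k i == digit k j].
have EC k w : E k w -> C w <-> k \in Q.
  move=> /signE[b sgn]; have [iN iE] := sgn i; have [jN jE] := sgn j.
  have -> : k \in Q = ((X i w < Xs i w) == (X j w < Xs j w)).
    by rewrite iE jE inE; case: (digit k i); case: (digit k j); case: (b).
  rewrite /C/=; case: (ltgtP (X i w) (Xs i w)) iN => // iw _;
  by case: (ltgtP (X j w) (Xs j w)) jN => // jw _; intuition.
have FQ : F Q `<=` C by move=> w [k Qk Ekw]; exact/(EC _ _ Ekw).
have FQc : F [predC Q] `<=` ~` C.
  by move=> w [k /= + Ekw] /(EC _ _ Ekw); rewrite inE => /negP.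
(* The events E_k with equal digits lie in C and the others lie in its
   complement; as their total mass is 1, both lower bounds are equalities. *)
have le1 : (Pr (F Q) <= Pr C)%E by apply: le_measure; rewrite ?inE.
have le2 : (Pr (F [predC Q]) <= Pr (~` C))%E.
  by apply: le_measure; rewrite ?inE//; exact: measurableC.
have sumQ : \sum_(k in Q) p k + \sum_(k in [predC Q]) p k = 1.
  by rewrite -p1 [RHS](bigID (mem Q)).
have PC : Pr C = (fine (Pr C))%:E by rewrite fineK// fin_num_measure.
move: le1 le2; rewrite probability_setC// !PF PC -EFinB !lee_fin => le1 le2.
rewrite (eq_bigl (mem Q))//=.
apply/le_anti; rewrite le1 andbT; lra.
Qed.

End partition.

(** * Binary digits *)

Lemma binary_digits_exist m (b : nat -> bool) :
  exists2 k, (k < 2 ^ m)%N & forall j, (j < m)%N -> odd (k %/ 2 ^ j) = b j.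
Proof.
elim: m b => [|m IH] b; first by exists 0%N.
have [k km kb] := IH (fun j => b j.+1).
exists (b 0%N + k.*2)%N.
  by rewrite expnS mul2n; case: (b 0%N);
    rewrite -?doubleS ?leq_double ?ltn_double.
case=> [_|j jm]; first by rewrite divn1 oddD odd_double addbF oddb.
rewrite expnS divnMA -kb//; congr (odd (_ %/ _)).
by rewrite divn2 half_bit_double.
Qed.

Lemma binary_digits_inj m k l : (k < 2 ^ m)%N -> (l < 2 ^ m)%N ->
  (forall j, (j < m)%N -> odd (k %/ 2 ^ j) = odd (l %/ 2 ^ j)) -> k = l.
Proof.
elim: m k l => [|m IH] k l; first by case: k => // _; case: l.
move=> km lm kl; rewrite -(odd_double_half k) -(odd_double_half l).
have /= := kl 0%N isT; rewrite !divn1 => ->; congr (_ + _.*2)%N.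
have half_lt x : (x < 2 ^ m.+1)%N -> (x./2 < 2 ^ m)%N.
  by rewrite expnS mul2n ltn_half_double.
apply: IH => [||j jm]; [exact: half_lt..|].
by have := kl j.+1 jm; rewrite expnS !divnMA !divn2.
Qed.

(** The leading digit of k < 2 ^ m, written with m + 1 digits, is 0: each pair
    of opposite sign vectors is represented by its member with leading digit
    0. *)
Lemma digit_ord0 m k : (k < 2 ^ m)%N -> digit k (ord0 : 'I_m.+1) = false.
Proof. by move=> km; rewrite /digit subn1 divn_small. Qed.

Lemma digit_inj m k l : (k < 2 ^ m)%N -> (l < 2 ^ m)%N ->
  (forall i : 'I_m.+1, digit k i = digit l i) -> k = l.
Proof.
move=> km lm kl; apply: (binary_digits_inj km lm) => j jm.
have jlt : (m - j < m.+1)%N by rewrite ltnS leq_subr.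
by have := kl (Ordinal jlt); rewrite /digit/= subSS subKn// ltnW.
Qed.

Lemma digit_exist m (b : 'I_m.+1 -> bool) : b ord0 = false ->
  exists2 k, (k < 2 ^ m)%N & forall i, digit k i = b i.
Proof.
move=> b0; have [k km kb] := binary_digits_exist m (fun j => b (inord (m - j))).
exists k => // i; have [->|i0] := eqVneq i ord0; first by rewrite digit_ord0.
have im : (i <= m)%N by rewrite -ltnS.
have i_gt0 : (0 < i)%N by rewrite lt0n.
rewrite /digit subSS kb; last by rewrite ltn_subrL i_gt0 (leq_trans i_gt0).
by rewrite subKn// inord_val.
Qed.

(** * Kendall matrices are mixtures of extremal matrices *)

Section kendall_is_mixture.
Context (R : realType) (m : nat) (disp : measure_display)
  (T : measurableType disp) (Pr : probability T R).
Variables X Xs : 'I_m.+1 -> {RV Pr >-> R}.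

Let orthant (s : 'I_m.+1 -> bool) : set T :=
  [set w | forall i, if s i then X i w < Xs i w else Xs i w < X i w].

Let measurable_orthant s : measurable (orthant s).
Proof.
rewrite (_ : orthant s = \bigcap_(i in [set: 'I_m.+1])
    [set w | if s i then X i w < Xs i w else Xs i w < X i w]); last first.
  by apply/seteqP; split => [w sw i _|w sw i]; exact: sw.
apply: fin_bigcap_measurable => // i _.
by case: (s i); exact: measurable_RV_lt.
Qed.

(** The sign pattern is the k-th one up to a global sign. *)
Let E (k : nat) : set T :=
  orthant (digit k) `|` orthant (fun i => ~~ digit k i).

Let E_sign k w : E k w ->
  exists b, forall i, X i w <> Xs i w /\ (X i w < Xs i w) = digit k i (+) b.
Proof.
by case=> Ekw; [exists false|exists true] => i; have := Ekw i;
  case: (digit k i) => /=; case: ltgtP => //= h _; split=> // e;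
  move: h; rewrite e ltxx.
Qed.

Lemma kendall_mx_mixture :
  continuous_margins X -> independent_copy X Xs ->
  exists w : 'I_(2 ^ m) -> R,
    [/\ forall k, 0 <= w k,
        \sum_(k < 2 ^ m) w k = 1
      & kendall_mx X Xs = \sum_(k < 2 ^ m) w k *: extremal_mx R m.+1 k].
Proof.
move=> cX indX.
have mE k : measurable (E k) by apply: measurableU.
have tE : trivIset [set: 'I_(2 ^ m)] E.
  apply/trivIsetP => k l _ _ /eqP kl; apply/seteqP; split => // w [Ek El].
  apply: kl; apply/val_inj/(@digit_inj m) => //= i.
  have [b kb] := E_sign Ek; have [c lc] := E_sign El.
  have [_ + ] := kb i; have [_ ->] := lc i.
  have [_ + ] := kb ord0; have [_ ->] := lc ord0.
  by rewrite !digit_ord0//= => ->;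
    case: (digit k i); case: (digit l i); case: (b).
have PU : Pr (\bigcup_(k in [set: 'I_(2 ^ m)]) E k) = 1%E.
  set U := \bigcup_(k in _) _.
  pose ties := \big[setU/set0]_(i < m.+1) [set w | X i w = Xs i w].
  have tiesE w : ~ ties w -> forall i, X i w <> Xs i w.
    by move=> tw i e; apply: tw; rewrite /ties (bigD1 i)//=; left.
  have [N [mN N0 tN]] : Pr.-negligible ties.
    apply: big_ind => [|A B|i _]; [exact: negligible_set0|exact: negligibleU|].
    apply/negligibleP; last exact: independent_copy_no_ties.
    rewrite (_ : mkset _ = [set w | X i w <= Xs i w] `&`
      [set w | Xs i w <= X i w]); last first.
      by apply/seteqP; split=> w /= => [->//|[? ?]]; apply/le_anti/andP.
    by apply: measurableI; exact: measurable_RV_le.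
  have mU : measurable U by apply: fin_bigcup_measurable.
  (* Without ties, the pattern relative to the coordinate 0 has leading digit
     0, hence is the digit vector of some k. *)
  have UN : ~` U `<=` N.
    apply: (subset_trans _ tN) => w; apply: contra_notP => /tiesE Xw.
    pose b i := (X i w < Xs i w) (+) (X ord0 w < Xs ord0 w).
    have [k km kb] := digit_exist (b := b) (addbb _).
    exists (Ordinal km) => //=.
    have sw i : if b i (+) (X ord0 w < Xs ord0 w)
        then X i w < Xs i w else Xs i w < X i w.
      by rewrite /b addbK; case: ltgtP (Xw i).
    by case e : (X ord0 w < Xs ord0 w); [right|left] => i; have := sw i;
      rewrite kb e ?addbT ?addbF.
  have : Pr (~` U) = 0%E.
    by apply: (subset_measure0 _ _ UN); [exact: measurableC|exact: mN|].
  rewrite probability_setC//.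
  have -> : Pr U = (fine (Pr U))%:E by rewrite fineK// fin_num_measure.
  by rewrite -EFinB => -[/eqP]; rewrite subr_eq0 => /eqP <-.
exists (fun k => fine (Pr (E k))).
have pE (k : 'I_(2 ^ m)) : Pr (E k) = (fine (Pr (E k)))%:E.
  by rewrite fineK// fin_num_measure.
have p1 : \sum_(k < 2 ^ m) fine (Pr (E k)) = 1.
  apply: EFin_inj; rewrite -PU -sumEFin.
  rewrite -(eq_bigr _ (fun k _ => pE k)) -measure_bigsetU_ord//.
  by rewrite -bigcup_pred; congr (Pr _); apply: eq_bigcupl.
split => //; first by move=> k; rewrite fine_ge0.
by apply: (@kendall_mx_partition _ _ _ _ _ _ _ _ E) => // k w /E_sign.
Qed.

End kendall_is_mixture.

(** * Independent copies on a product space *)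

Section product_copy.
Context (R : realType) (d : nat) (disp : measure_display)
  (T : measurableType disp) (mu : probability T R) (f : 'I_d -> {mfun T >-> R}).

Definition square_probability : probability (T * T)%type R :=
  (mu \x mu)%E.

Lemma square_probabilityX A B : measurable A -> measurable B ->
  square_probability (A `*` B) = (mu A * mu B)%E.
Proof. by move=> mA mB; exact: product_measure1E. Qed.

Let mf1 i : measurable_fun setT (fun z : T * T => f i z.1).
Proof. exact: measurableT_comp. Qed.

Let mf2 i : measurable_fun setT (fun z : T * T => f i z.2).
Proof. exact: measurableT_comp. Qed.

Definition fst_copy i : {RV square_probability >-> R} :=
  HB.pack (fun z : T * T => f i z.1) (isMeasurableFun.Build _ _ _ _ _ (mf1 i)).

Definition snd_copy i : {RV square_probability >-> R} :=
  HB.pack (fun z : T * T => f i z.2) (isMeasurableFun.Build _ _ _ _ _ (mf2 i)).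

Lemma independent_copy_fst_snd : independent_copy fst_copy snd_copy.
Proof.
pose g z : d.-tuple R := [tuple f i z | i < d].
have mg A : measurable A -> measurable (g @^-1` A).
  rewrite -[X in measurable X -> _]setTI => mA; rewrite -[g @^-1` A]setTI.
  suff : measurable_fun setT g by apply => //; rewrite -[A]setTI.
  apply/measurable_fun_tnthP => i.
  by rewrite (_ : _ \o _ = f i) //; apply/funext => z /=; rewrite tnth_mktuple.
have fstE A : joint fst_copy @^-1` A = (g @^-1` A) `*` setT.
  by apply/seteqP; split => [z //|z []].
have sndE A : joint snd_copy @^-1` A = setT `*` (g @^-1` A).
  by apply/seteqP; split => [z //|z []].
split=> [A mA|A B mA mB]; rewrite fstE sndE.
  rewrite !square_probabilityX ?probability_setT ?mule1 ?mul1e//; exact: mg.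
rewrite -setXI setTI setIT !square_probabilityX ?probability_setT ?mule1
  ?mul1e//; exact: mg.
Qed.

Lemma continuous_margins_fst_copy :
  (forall i a, mu (f i @^-1` [set a]) = 0%E) -> continuous_margins fst_copy.
Proof.
move=> f0 i; apply/continuous_cdfP => a.
rewrite (_ : _ @^-1` _ = (f i @^-1` [set a]) `*` setT); last first.
  by apply/seteqP; split => [z //|z []].
have mfa : measurable (f i @^-1` [set a]) by exact: measurable_funPTI.
by rewrite square_probabilityX// f0 mul0e.
Qed.

End product_copy.

(** * The uniform law on [0, 1] *)

Section uniform.
Context (R : realType).

(** [uniform_prob] lives on [measurableTypeR R], whose display differs from the
    one of the measurable structure of [R]; the identity transports it. *)
Let to_borel : measurableTypeR R -> R := idfun.

Let measurable_to_borel : measurable_fun setT to_borel.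
Proof. exact: measurable_id. Qed.

HB.instance Definition _ :=
  isMeasurableFun.Build _ _ _ _ to_borel measurable_to_borel.

Definition uniform01 : probability R R :=
  distribution (uniform_prob (@ltr01 R)) to_borel.

Let uniform01E (A : set R) : uniform01 A = uniform_prob (@ltr01 R) A.
Proof. by []. Qed.

Lemma uniform01_set1 (x : R) : uniform01 [set x] = 0%E.
Proof.
rewrite uniform01E.
have /null_content_dominatesP := dominates_uniform_prob (@ltr01 R).
by apply; [exact: measurable_set1|exact: lebesgue_measure_set1].
Qed.

Lemma uniform01_itvNyc (a : R) :
  0 <= a <= 1 -> uniform01 `]-oo, a]%classic = a%:E.
Proof.
move=> /andP[a0 a1].
rewrite uniform01E /uniform_prob integral_uniform_pdf.
rewrite (_ : _ `&` _ = `[0, a]%classic); last first.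
  apply/seteqP; split => x /=; rewrite !in_itv/=.
    by case=> -> /andP[-> _].
  by move=> /andP[-> xa]; rewrite xa (le_trans xa a1).
rewrite (eq_integral (fun=> 1%E)); last first.
  move=> x; rewrite inE/= in_itv/= /uniform_pdf => /andP[-> xa].
  by rewrite (le_trans xa a1) subr0 invr1.
rewrite integral_cst//= mul1e.
rewrite lebesgue_measure_itv/= lte_fin.
by case: ltgtP a0 => [_|//|<-] _; rewrite ?sube0 // -EFinD subr0.
Qed.

End uniform.

(** * Mixtures of extremal matrices are Kendall matrices *)

Section kendall_of_mixture.
Context (R : realType) (d n : nat).
Variable w : 'I_n -> R.
Hypotheses (w_ge0 : forall k, 0 <= w k) (w_sum1 : \sum_k w k = 1).
Local Notation mu := (uniform01 R).

Let cumul (k : nat) : R := \sum_(l < n | (l < k)%N) w l.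

Let cumul_ge0 k : 0 <= cumul k.
Proof. by apply: sumr_ge0. Qed.

Let cumulS (k : 'I_n) : cumul k.+1 = cumul k + w k.
Proof.
rewrite /cumul (bigD1 k)//= addrC; congr (_ + _); apply: eq_bigl => l.
by rewrite ltnS ltn_neqAle andbC.
Qed.

Let cumul_nd : {homo cumul : k l / (k <= l)%N >-> k <= l}.
Proof.
move=> k l kl; rewrite /cumul big_mkcond [leRHS]big_mkcond/=.
apply: ler_sum => i _; case: ifP => [ik|_]; last by case: ifP.
by rewrite (leq_trans ik kl).
Qed.

Let cumul_le1 k : cumul k <= 1.
Proof.
rewrite -w_sum1 [leRHS](bigID (fun l : 'I_n => (l < k)%N))/= lerDl.
exact: sumr_ge0.
Qed.

(** The square root makes a k.+1 ^+ 2 - a k ^+ 2 equal to w k, the probability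
    that the maximum of two independent uniform variables lies in slice k. *)
Let a (k : nat) : R := Num.sqrt (cumul k).

Let a_nd : {homo a : k l / (k <= l)%N >-> k <= l}.
Proof. by move=> k l kl; exact/ler_wsqrtr/cumul_nd. Qed.

Let a_in01 k : 0 <= a k <= 1.
Proof. by rewrite sqrtr_ge0/= -[leRHS]sqrtr1; exact: ler_wsqrtr. Qed.

Let slice (k : nat) : set R := `]a k, a k.+1].

Let slice_inj (k l : nat) x : slice k x -> slice l x -> k = l.
Proof.
wlog kl : k l / (k <= l)%N.
  move=> H kx lx; have [kl|/ltnW lk] := leqP k l; first exact: H.
  exact/esym/H.
rewrite /slice/= !in_itv/= => /andP[_ xk] /andP[lx _].
apply/eqP; rewrite eqn_leq kl leqNgt; apply/negP => /a_nd /(le_trans xk).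
by rewrite leNgt lx.
Qed.

Let band (i : 'I_d) : set R :=
  \bigcup_(k in [set k : 'I_n | digit k i]) slice k.

Let measurable_band i : measurable (band i).
Proof. by apply: fin_bigcup_measurable => // k _; exact: measurable_itv. Qed.

Let band_slice i (k : 'I_n) x : slice k x -> (x \in band i) = digit k i.
Proof.
move=> kx; apply/idP/idP; rewrite inE; last by move=> ki; exists k.
by case=> l /= li lx; rewrite (slice_inj kx lx).
Qed.

(** Inside slice k the coordinate i is x or -x according to the digit i of k;
    in all cases its absolute value is that of x, which is what keeps the
    margins atomless and lets the larger of two points decide the comparison. *)
Let fold (i : 'I_d) (x : R) : R := if x \in band i then x else - x.

Let measurable_fold i : measurable_fun setT (fold i).
Proof.
apply: measurable_fun_ifT => //.
  apply: (measurable_fun_bool true); rewrite // setTI.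
  rewrite (_ : _ @^-1` _ = band i)//.
  by apply/seteqP; split => x /=; [exact: set_mem|exact: mem_set].
Qed.

Let f (i : 'I_d) : {mfun R >-> R} :=
  HB.pack (fold i) (isMeasurableFun.Build _ _ _ _ _ (measurable_fold i)).

Let f_atomless i x : mu (f i @^-1` [set x]) = 0%E.
Proof.
have N0 : mu ([set x] `|` [set - x]) = 0%E.
  by rewrite measureU0//; exact: uniform01_set1.
apply: (subset_measure0 _ _ _ N0).
- by rewrite -[X in measurable X]setTI; exact: measurable_fold.
- by apply: measurableU; exact: measurable_set1.
- by move=> y /=; rewrite /fold; case: ifP => _ <-; [left|right; rewrite opprK].
Qed.

Let P := square_probability mu.

Let below (b : R) : set (R * R) := `]-oo, b] `*` `]-oo, b].

(** Off this set both coordinates are positive and distinct. *)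
Let null : set (R * R) :=
  [set z | z.1 = z.2] `|` (`]-oo, 0%R] `*` setT) `|` (setT `*` `]-oo, 0%R]).

(** The maximum of the two coordinates lies in slice k. *)
Let E (k : nat) : set (R * R) := (below (a k.+1) `\` below (a k)) `\` null.

Let measurable_below b : measurable (below b).
Proof. by apply: measurableX; exact: measurable_itv. Qed.

Let measurable_null : measurable null.
Proof.
apply: measurableU; first apply: measurableU; first exact: measurable_diag.
all: by apply: measurableX => //; exact: measurable_itv.
Qed.

Let P_below b : 0 <= b <= 1 -> P (below b) = (b ^+ 2)%:E.
Proof.
move=> b01; rewrite /below square_probabilityX//.
by rewrite uniform01_itvNyc// -EFinM expr2.
Qed.

Let P_null : P null = 0%E.
Proof.
have mu0 : mu `]-oo, 0%R]%classic = 0%E.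
  by rewrite uniform01_itvNyc// lexx ler01.
have mNy0 : measurable (`]-oo, 0%R]%classic : set R) by exact: measurable_itv.
have P1 : P (`]-oo, 0%R] `*` setT) = 0%E.
  by rewrite square_probabilityX// mu0 mul0e.
have P2 : P (setT `*` `]-oo, 0%R]) = 0%E.
  by rewrite square_probabilityX// mu0 mule0.
rewrite /null !measureU0//.
- by apply: product_measure_diag; exact: uniform01_set1.
- exact: measurable_diag.
- exact: measurableX.
- by apply: measurableU; [exact: measurable_diag|exact: measurableX].
- exact: measurableX.
Qed.

Let P_E (k : 'I_n) : P (E k) = (w k)%:E.
Proof.
have mD : measurable (below (a k.+1) `\` below (a k)) by exact: measurableD.
have sub : below (a k) `<=` below (a k.+1).
  by move=> z [/= + +]; rewrite !in_itv/= => z1 z2;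
    split; rewrite /= in_itv/=; apply: le_trans (a_nd (leqnSn k)).
have : P (below (a k.+1)) = (P (E k) + P (below (a k)))%E.
  rewrite (measureDI P (measurable_below (a k.+1)) (measurable_below (a k))).
  rewrite setIidr//; congr (_ + _)%E.
  rewrite (measureDI P mD measurable_null) -[RHS]adde0; congr (_ + _)%E.
  by apply: (subset_measure0 _ _ _ P_null) => //; exact: measurableI.
rewrite !P_below// !sqr_sqrtr// cumulS.
have -> : P (E k) = (fine (P (E k)))%:E.
  by rewrite fineK// fin_num_measure//; apply: measurableD.
by rewrite -EFinD => -[]; rewrite addrC => /addIr ->.
Qed.

Let E_slice k z : E k z ->
  [/\ 0 < z.1, 0 < z.2 & z.1 < z.2 /\ slice k z.2 \/ z.2 < z.1 /\ slice k z.1].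
Proof.
case=> -[[/= + + zk] zN]; rewrite !in_itv/= => z1 z2.
have z1_gt0 : 0 < z.1.
  rewrite ltNge; apply/negP => z1_le0; apply: zN; left; right.
  by split; rewrite //= in_itv.
have z2_gt0 : 0 < z.2.
  rewrite ltNge; apply/negP => z2_le0; apply: zN; right.
  by split; rewrite //= in_itv.
have zk' : a k < z.1 \/ a k < z.2.
  apply/orP; rewrite !ltNge -negb_and; apply/negP => /andP[l1 l2].
  by apply: zk; split; rewrite /= in_itv.
split=> //; rewrite /slice/= !in_itv/=.
case: (ltgtP z.1 z.2) => [z12|z21|e]; last by case: zN; left; left.
- left; split=> //; rewrite z2 andbT; case: zk' => // /lt_trans; exact.
- right; split=> //; rewrite z1 andbT; case: zk' => // /lt_trans; exact.
Qed.

Lemma kendall_mx_of_mixture :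
  kendall_rank_correlation_mx (\sum_(k < n) w k *: extremal_mx R d k).
Proof.
exists _, _, P, (fst_copy mu f), (snd_copy mu f); split.
- exact: continuous_margins_fst_copy.
- exact: independent_copy_fst_snd.
apply/esym/(@kendall_mx_partition _ _ _ _ _ _ _ _ E) => //.
- move=> k; apply: measurableD => //; exact: measurableD.
- apply/trivIsetP => k l _ _ /eqP kl; apply/seteqP; split => // z [Ek El].
  apply/kl/val_inj => /=; have [_ _ zk] := E_slice Ek.
  have [_ _ zl] := E_slice El.
  case: zk zl => -[z12 zk] [[z12' zl]|[z12' zl]];
    by [exact: slice_inj zk zl|move: (lt_trans z12 z12'); rewrite ltxx].
move=> k z /E_slice[z1 z2 [[z12 zk]|[z12 zk]]].
(* The larger coordinate is z.2: the copy exceeds the original exactly when the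
   digit is 1, so there is no global sign change. *)
- exists false => i; rewrite /= /fold (band_slice i zk).
  by case: (digit k i); case: (_ \in _); split => /=; try lra; apply/idP; lra.
(* The larger coordinate is z.1, which reverses every comparison. *)
- exists true => i; rewrite /= /fold (band_slice i zk).
  by case: (digit k i); case: (_ \in _); split => /=; try lra; apply/idP; lra.
Qed.

End kendall_of_mixture.

Theorem theorem3 (R : realType) (d : nat) (hd : (2 <= d)%N) (P : 'M[R]_d)
    (hP : correlation_mx P) :
  kendall_rank_correlation_mx P <->
  exists w : 'I_(2 ^ d.-1) -> R,
    [/\ forall k, 0 <= w k,
        \sum_(k < 2 ^ d.-1) w k = 1
      & P = \sum_(k < 2 ^ d.-1) w k *: extremal_mx R d k].
Proof.
split=> [|[w [w_ge0 w_sum1 ->]]]; last exact: kendall_mx_of_mixture.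
case: d hd P hP => // m _ P _ [disp [T [Pr [X [Xs [cX indX ->]]]]]].
exact: kendall_mx_mixture.
Qed.
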